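(* Let $K$ be a field, $S=K[x_1,\ldots,x_n]$, let $u_1,\ldots,u_m\ne1$ be squarefree monomials in $S$, and let $I$ be the squarefree Borel ideal with Borel generators $u_1,\ldots,u_m$. For $1\le i\le m$ let $B_{1i}$ be the first block of $u_i$. Suppose there exists an integer $j$ with $1\le j\le m$ such that $B_{1j}\subseteq B_{1i}$ for all $1\le i\le m$. Then the multiplicity of $S/I$ is $$e(S/I)=\binom{\max(B_{1j})}{|B_{1j}|-1}.$$
   Context: $\operatorname{supp}(u)=\{i:x_i\mid u\}$. A squarefree monomial ideal $I$ (one generated by squarefree monomials) is a squarefree Borel ideal (also called $1$-Borel) if for every squarefree monomial $u\in I$, every $j\in\operatorname{supp}(u)$ and every $i<j$ one has $x_i(u/x_j)\in I$, provided $x_i(u/x_j)$ is squarefree. The squarefree Borel ideal with Borel generators $u_1,\ldots,u_m$ is the smallest squarefree Borel ideal containing $u_1,\ldots,u_m$; the $u_i$ need not have the same degree. A block of a squarefree monomial $u$ is a subset of $\operatorname{supp}(u)$ consisting of consecutive integers; a block is maximal if it is not properly contained in another block of $u$. $\operatorname{supp}(u)$ is uniquely the disjoint union of its maximal blocks, and the first block of $u$ is the maximal block containing $\min(\operatorname{supp}(u))$. *)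

(* Defs.v *)
From HB Require Import structures.
From mathcomp Require Import all_boot all_order all_algebra.
From mathcomp Require Export mpoly.

Set Implicit Arguments.
Unset Strict Implicit.
Unset Printing Implicit Defensive.

Import GRing.Theory.
Local Open Scope ring_scope.

(* S = K[x_1, ..., x_n] is {mpoly K[n]}; the variable x_(i+1) is 'X_i for the
   0-based index i : 'I_n.  Monomials are exponent vectors u : 'X_{1..n}, and
   'X_[u] is the corresponding element of S. *)

Section Monomials.
Variable n : nat.
Implicit Types (u : 'X_{1..n}) (B : {set 'I_n}).

Definition msupport u : {set 'I_n} := [set i | (0 < u i)%N].

Definition sqfree u : bool := [forall i, (u i <= 1)%N].

(* Every integer between two elements of B is in B. *)
Definition consecutive B : bool :=
  [forall a in B, forall b in B, forall c : 'I_n,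
     (a <= c <= b)%N ==> (c \in B)].

Definition block u B : bool := (B \subset msupport u) && consecutive B.

Definition maximal_block u B : bool := maxset (block u) B.

Definition first_block u B : bool :=
  maximal_block u B &&
  [exists i in B, (i \in msupport u) && [forall k in msupport u, (i <= k)%N]].

(* The maximum of B as a set of indices in {1, ..., n}, hence the shift. *)
Definition max_index B : nat := (\max_(i in B) i.+1)%N.

End Monomials.

Section Ideals.
Variables (K : fieldType) (n : nat).
Implicit Types I J : {mpoly K[n]} -> Prop.

Definition ideal_gen k (g : 'I_k -> {mpoly K[n]}) (p : {mpoly K[n]}) : Prop :=
  exists a : 'I_k -> {mpoly K[n]}, p = \sum_(i < k) a i * g i.

Definition sqfree_monomial_ideal I : Prop :=
  exists (k : nat) (g : 'I_k -> 'X_{1..n}),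
    (forall i, sqfree (g i)) /\
    (forall p, I p <-> ideal_gen (fun i => 'X_[g i]) p).

(* For j in supp(u), (u - U_(j) + U_(i))%MM is the exponent of x_i (u / x_j). *)
Definition sqfree_borel I : Prop :=
  sqfree_monomial_ideal I /\
  forall u : 'X_{1..n}, sqfree u -> I 'X_[u] ->
  forall i j : 'I_n, j \in msupport u -> (i < j)%N ->
    sqfree (u - U_(j) + U_(i))%MM -> I 'X_[(u - U_(j) + U_(i))%MM].

Definition sqfree_borel_generated I m (u : 'I_m -> 'X_{1..n}) : Prop :=
  [/\ sqfree_borel I,
      forall i, I 'X_[u i]
    & forall J, sqfree_borel J -> (forall i, J 'X_[u i]) ->
      forall p, I p -> J p].

(* dim_K (S/I)_t = h, for a homogeneous ideal I: the classes of f_1, ..., f_h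
   form a K-basis of S_t / (I \cap S_t). *)
Definition graded_quot_dim I (t h : nat) : Prop :=
  exists f : 'I_h -> {mpoly K[n]},
    (forall i, f i \is t.-homog) /\
    forall p : {mpoly K[n]}, p \is t.-homog ->
      exists! c : {ffun 'I_h -> K}, I (p - \sum_(i < h) c i *: f i).

Definition hilbert_function I (H : nat -> nat) : Prop :=
  forall t, graded_quot_dim I t (H t).

(* e(S/I) for a homogeneous ideal I.  Let P be the Hilbert polynomial of S/I
   and d = dim S/I.  If d > 0 then deg P = d - 1 and e(S/I) is (d - 1)! times
   the leading coefficient of P.  If d = 0, i.e. P = 0, then e(S/I) is the
   length of S/I, i.e. the sum of all values of the Hilbert function. *)
Definition is_multiplicity I (e : nat) : Prop :=
  exists (H : nat -> nat) (P : {poly rat}) (N : nat),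
    [/\ hilbert_function I H,
        forall t, (N <= t)%N -> P.[t%:R] = (H t)%:R
      & e%:R = if P == 0 then (\sum_(t < N) H t)%N%:R
               else ((size P).-1)`!%:R * lead_coef P].

End Ideals.

(* Main.v *)
Require Import Defs.
From mathcomp Require Import all_boot all_order all_algebra.

Set Implicit Arguments.
Unset Strict Implicit.
Unset Printing Implicit Defensive.

Import GRing.Theory.
Local Open Scope ring_scope.

(** A squarefree monomial ideal I is determined by its faces, the sets F of
    variables whose product x_F is not in I: a polynomial lies in I iff the
    support of each of its monomials is a non-face.  The monomials with face
    support form a basis of S/I, and a nonempty set F is the support of
    binomial(t-1, |F|-1) monomials of degree t.  The Hilbert polynomial is
    therefore the sum of the polynomials binomial(t-1, |F|-1) over the nonempty
    faces, and the multiplicity is the number of faces of largest cardinality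
    ([sr_multiplicity]).

    It remains to find these faces for the given Borel ideal.  With 0-based
    indices, let the smallest first block be B_j = [p, q), so that
    q = max_index B_j.

    - The Borel moves show that x_F is in I as soon as x_U is and F has, below
      every threshold c, at least as many elements as U
      ([sqfree_borel_below]).  Taking for U the support of u_j, which avoids
      both [0, p) and q, one finds that the complement of a face has at least
      p + 1 elements, and lies in [0, q) if it has exactly p + 1 of them
      ([card_below_first_block]).

    - The squarefree monomials x_F such that F misses at most p elements of
      [0, q) span a squarefree Borel ideal ([sqfree_borel_missing]).  It
      contains every u_i, because the support of u_i contains B_j, hence it
      contains I.  So the complement of any (p + 1)-subset of [0, q) is a face.

    The largest faces are thus the complements of the (p + 1)-subsets of
    [0, q).  There are binomial(q, p + 1) = binomial(q, q - p - 1) of them, and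
    |B_j| - 1 = q - p - 1. *)

(** * Squarefree monomial ideals and their faces *)

Section StanleyReisner.
Variables (K : fieldType) (n : nat).
Implicit Types (I : {mpoly K[n]} -> Prop) (p : {mpoly K[n]}).
Implicit Types (m : 'X_{1..n}) (F G : {set 'I_n}) (face : pred {set 'I_n}).

(** The Stanley-Reisner ideal of a simplicial complex on the variables, given by
    the predicate [face]: the polynomials without any monomial supported on a
    face.  This set is an ideal as soon as [face] is closed under subsets. *)
Definition sr_ideal face p : Prop :=
  forall m, m \in msupp p -> ~~ face (msupport m).

Definition down_closed face : Prop :=
  forall F G, F \subset G -> face G -> face F.

Lemma msupport_mesym1 F : msupport (mesym1 F) = F.
Proof. by apply/setP => i; rewrite inE mnmE; case: (i \in F). Qed.

Lemma sqfree_mesym1 F : sqfree (mesym1 F).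
Proof. by apply/forallP => i; rewrite mnmE leq_b1. Qed.

Lemma mesym1_msupport m : sqfree m -> mesym1 (msupport m) = m.
Proof.
move=> /forallP sq; apply/mnmP => i; rewrite mnmE inE.
by move: (sq i); case: (m i) => [|[]].
Qed.

Lemma sqfree_lepm m m' :
  sqfree m -> (m <= m')%MM = (msupport m \subset msupport m').
Proof.
move=> /forallP sq; apply/mnm_lepP/subsetP => [le i|sub i].
  by rewrite !inE => /leq_trans; apply.
have := sub i; rewrite !inE; case: (m i) (sq i) => [//|[|//]] _.
by move=> /(_ isT).
Qed.

(** Membership in a monomial ideal can be tested on each monomial. *)
Lemma ideal_gen_monomialP k (g : 'I_k -> 'X_{1..n}) p :
  ideal_gen (fun i => 'X_[g i] : {mpoly K[n]}) p <->
  (forall m, m \in msupp p -> exists i, (g i <= m)%MM).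
Proof.
split=> [[a ->] m|H].
  rewrite mcoeff_msupp raddf_sum /= => nz.
  have [/existsP [i nzi]|] :=
    boolP [exists i, (a i * 'X_[g i])@_m != 0 :> K].
    exists i; move: nzi; rewrite -mcoeff_msupp (perm_mem (msuppMX _ _)).
    by case/mapP => m' _ ->; apply: lem_addr.
  rewrite negb_exists => /forallP z; case/negP: nz.
  by rewrite big1 // => i _; apply/eqP; have := z i; rewrite negbK.
rewrite (mpolyE p) big_seq; apply: (big_ind (ideal_gen _)).
- by exists (fun=> 0); rewrite big1 // => i _; rewrite mul0r.
- move=> _ _ [a ->] [b ->]; exists (fun i => a i + b i).
  by rewrite -big_split /=; apply: eq_bigr => i _; rewrite mulrDl.
- move=> m /H [i le].
  exists (fun l => if l == i then p@_m *: 'X_[m - g i] else 0).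
  rewrite (bigD1 i) //= eqxx big1 => [|l /negPf->]; last by rewrite mul0r.
  by rewrite addr0 -scalerAl -mpolyXD submK.
Qed.

Lemma sr_idealX face m : sr_ideal face 'X_[m] <-> ~~ face (msupport m).
Proof.
split=> [/(_ m)|H m']; rewrite msuppX inE; last by move/eqP->.
by rewrite eqxx => /(_ isT).
Qed.

Lemma sqfree_monomial_idealP I : sqfree_monomial_ideal I ->
  exists2 face, down_closed face & forall p, I p <-> sr_ideal face p.
Proof.
move=> [k [g [sq Ig]]].
exists (fun F => ~~ [exists i, msupport (g i) \subset F]).
  move=> F G FG; apply: contra => /existsP [i gF]; apply/existsP; exists i.
  exact: subset_trans gF FG.
move=> p; rewrite Ig ideal_gen_monomialP; split=> H m /H.
  by case=> i le; rewrite negbK; apply/existsP; exists i; rewrite -sqfree_lepm.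
by rewrite negbK => /existsP [i]; rewrite -sqfree_lepm //; exists i.
Qed.

Lemma sr_ideal_sqfree face : down_closed face ->
  sqfree_monomial_ideal (sr_ideal face).
Proof.
move=> dc; exists #|[set F | ~~ face F]|, (fun i => mesym1 (enum_val i)).
split=> [i|p]; first exact: sqfree_mesym1.
rewrite ideal_gen_monomialP; split=> H m /H.
  move=> nf; have mI : msupport m \in [set F | ~~ face F] by rewrite inE.
  exists (enum_rank_in mI (msupport m)).
  by rewrite enum_rankK_in // sqfree_lepm ?sqfree_mesym1 // msupport_mesym1.
move=> [i]; rewrite sqfree_lepm ?sqfree_mesym1 // msupport_mesym1 => /dc.
by have := enum_valP i; rewrite inE => nf /contra; apply.
Qed.

(** * Hilbert function *)

(** The number of monomials of degree [t] supported on a face.  The bound [t.+1]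
    on the degree only serves to make the type of monomials finite. *)
Definition sr_hilbert face t : nat :=
  #|[set m : 'X_{1..n < t.+1} | (mdeg m == t) && face (msupport m)]|.

Lemma sr_hilbert_function I face :
  (forall p, I p <-> sr_ideal face p) -> hilbert_function I (sr_hilbert face).
Proof.
move=> IE t; rewrite /sr_hilbert; set A := [set m | _].
pose e (i : 'I_#|A|) : 'X_{1..n} := enum_val i.
have e_inj : injective e by move=> i l /val_inj /enum_val_inj.
have eA i : (mdeg (e i) == t) && face (msupport (e i)).
  by have := enum_valP i; rewrite inE.
exists (fun i => 'X_[e i]); split=> [i|p /dhomogP hp].
  by rewrite dhomogX; case/andP: (eA i).
have co (c : {ffun 'I_#|A| -> K}) i :
    (p - \sum_(l < #|A|) c l *: 'X_[e l])@_(e i) = p@_(e i) - c i.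
  rewrite mcoeffB raddf_sum (bigD1 i) //= mcoeffZ mcoeffX eqxx mulr1.
  rewrite big1 ?addr0 // => l ne; rewrite mcoeffZ mcoeffX (inj_eq e_inj).
  by rewrite (negPf ne) mulr0.
exists [ffun i => p@_(e i)]; split=> [|c /IE Hc].
  apply/IE => m.
  rewrite mcoeff_msupp; apply: contraNN => fm.
  have [dm|dm] := eqVneq (mdeg m) t.
    have mb : (mdeg m < t.+1)%N by rewrite dm.
    have mA : BMultinom mb \in A by rewrite inE /= dm eqxx.
    have -> : m = e (enum_rank_in mA (BMultinom mb)).
      by rewrite /e enum_rankK_in.
    by rewrite co ffunE subrr.
  rewrite mcoeffB raddf_sum big1 ?subr0.
    by rewrite mcoeff_eq0; apply/negP => /hp /eqP; rewrite (negPf dm).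
  move=> i _; rewrite /= mcoeffZ mcoeffX; have [em|] := eqVneq (e i) m.
    by have /andP [] := eA i; rewrite em (negPf dm).
  by rewrite mulr0.
apply/ffunP => i; rewrite ffunE; apply/eqP; rewrite -subr_eq0 -co mcoeff_eq0.
by apply/negP => /Hc; case/andP: (eA i) => _ ->.
Qed.

Lemma sr_hilbert_sum face t :
  sr_hilbert face t = (\sum_(F | face F)
    #|[set m : 'X_{1..n < t.+1} | (mdeg m == t) && (msupport m == F)]|)%N.
Proof.
rewrite /sr_hilbert -sum1dep_card.
rewrite (partition_big (fun m : 'X_{1..n < t.+1} => msupport m) face);
  last by move=> m /andP [].
apply: eq_bigr => F fF; rewrite -sum1dep_card; apply: eq_bigl => m.
by case: (eqVneq (msupport m) F) => [->|]; rewrite ?fF ?andbF ?andbT.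
Qed.

End StanleyReisner.

Section MonomialCount.
Variable n : nat.
Implicit Types (m : 'X_{1..n}) (F : {set 'I_n}).

Lemma card_msupport_le m : (#|msupport m| <= mdeg m)%N.
Proof.
rewrite mdegE -sum1_card big_mkcond; apply: leq_sum => i _.
by rewrite inE; case: (m i).
Qed.

(** Lowering every positive exponent by one identifies the monomials of degree
    [t.+1] and support [F] with the [#|F|]-tuples of naturals whose sum is
    [t.+1 - #|F|]. *)
Lemma card_monomials_support F t : F != set0 ->
  #|[set m : 'X_{1..n < t.+2} | (mdeg m == t.+1) && (msupport m == F)]|
    = 'C(t, #|F|.-1).
Proof.
move=> Fn0; have F0 : (0 < #|F|)%N by rewrite card_gt0.
case: (ltnP t #|F|.-1) => [lt|le].
  rewrite bin_small //; apply/eqP; rewrite cards_eq0; apply/eqP/setP => m.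
  rewrite !inE; apply/negP => /andP [/eqP dm /eqP sm].
  by have := card_msupport_le m; rewrite sm dm leqNgt -(prednK F0) ltnS lt.
have [k Ek] : exists k, #|F| = k.+1 by exists #|F|.-1; rewrite prednK.
rewrite Ek /= in le *; pose s := (t - k)%N.
have Et : t = (k + s)%N by rewrite subnKC.
have -> : 'C(t, k) = 'C(k + s, k) by rewrite -Et.
rewrite -(card_ord_partitions k s).
pose ex (v : k.+1.-tuple 'I_s.+1) i :=
  (if i \in F then (nth ord0 v (index i (enum F))).+1 else 0)%N.
pose f v : 'X_{1..n} := [multinom ex v i | i < n].
have sF : size (enum F) = k.+1 by rewrite -cardE.
have [a0 a0F] : exists a, a \in F by apply/set0Pn.
have fsupp v : msupport (f v) = F.
  by apply/setP => i; rewrite inE mnmE /ex; case: (i \in F).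
have fsum (h : 'I_n -> nat) :
    (\sum_(i in F) h i = \sum_(l < k.+1) h (nth a0 (enum F) l))%N.
  by rewrite -[LHS]big_enum (big_nth a0) sF big_mkord.
have fdeg v : mdeg (f v) = (k.+1 + \sum_(i <- v) i)%N.
  rewrite mdegE (eq_bigr (ex v)) => [|i _]; last by rewrite mnmE.
  rewrite -big_mkcond fsum (big_nth ord0) size_tuple big_mkord.
  rewrite (eq_bigr (fun l : 'I_k.+1 => 1 + nth ord0 v l)%N) => [|l _].
    by rewrite big_split /= sum1_card card_ord.
  by rewrite index_uniq ?sF ?enum_uniq.
pose fb v : 'X_{1..n < t.+2} := insubd (bm0 : 'X_{1..n < t.+2}) (f v).
have fbE (v : k.+1.-tuple 'I_s.+1) :
    (\sum_(i <- v) i)%N = s -> fb v = f v :> 'X_{1..n}.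
  by move=> sv; rewrite /fb insubdK // unfold_in fdeg sv addSn -Et.
rewrite -(card_in_imset (f := fb)); last first.
  move=> v w; rewrite !inE => /eqP sv /eqP sw /(congr1 (@bmnm _ _)).
  rewrite !fbE // => efg; apply: eq_from_tnth => l.
  move/mnmP: efg => /(_ (nth a0 (enum F) l)); rewrite !mnmE /ex.
  rewrite -mem_enum mem_nth ?sF // index_uniq ?sF ?enum_uniq // => -[].
  by rewrite !(tnth_nth ord0) => /val_inj.
apply: eq_card => m; rewrite inE; apply/andP/imsetP => [[/eqP dm /eqP sm]|[v]].
  have mF i : (0 < m i)%N = (i \in F) by rewrite -sm inE.
  pose v : k.+1.-tuple 'I_s.+1 :=
    [tuple inord (m (nth a0 (enum F) l)).-1 | l < k.+1].
  have dmF : (k.+1 + \sum_(l < k.+1) (m (nth a0 (enum F) l)).-1)%N = t.+1.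
    rewrite -[RHS]dm mdegE (bigID (mem F)) /=.
    rewrite [X in (_ = _ + X)%N]big1 ?addn0; last first.
      by move=> i; rewrite -mF lt0n negbK => /eqP.
    rewrite fsum -{1}(card_ord k.+1) -sum1_card -big_split.
    apply: eq_bigr => l _ /=.
    by rewrite add1n prednK // mF -mem_enum mem_nth // sF.
  have sumE : (\sum_(l < k.+1) (m (nth a0 (enum F) l)).-1)%N = s.
    by apply: (@addnI k.+1); rewrite dmF addSn -Et.
  have vE (l : 'I_k.+1) : tnth v l = (m (nth a0 (enum F) l)).-1 :> nat.
    rewrite tnth_mktuple inordK // ltnS -sumE (bigD1 l) //=; exact: leq_addr.
  have sv : (\sum_(i <- v) i)%N = s.
    by rewrite -[RHS]sumE big_tuple; apply: eq_bigr => l _; rewrite vE.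
  exists v; first by rewrite inE sv.
  apply: val_inj; rewrite /= fbE //; apply/mnmP => i; rewrite mnmE /ex.
  case: ifP => [iF|]; last by rewrite -mF lt0n => /negbT; rewrite negbK => /eqP.
  have ik : (index i (enum F) < k.+1)%N by rewrite -sF index_mem mem_enum.
  have := vE (Ordinal ik); rewrite (tnth_nth ord0) /= => ->.
  by rewrite nth_index ?mem_enum // prednK // mF.
rewrite inE => /eqP sv ->; rewrite fbE // fsupp fdeg sv addSn -Et.
by split.
Qed.

End MonomialCount.

(** * Multiplicity *)

(** The polynomial of degree [k] taking the value binomial(t - 1, k) at every
    positive integer [t]. *)
Definition binpoly k : {poly rat} :=
  (k`!%:R^-1) *: \prod_(0 <= i < k) ('X - (i.+1%:R)%:P).

Lemma fact_neq0 k : k`!%:R != 0 :> rat.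
Proof. by rewrite Num.Theory.pnatr_eq0 -lt0n fact_gt0. Qed.

Lemma binpolyE k t : (binpoly k).[t.+1%:R] = 'C(t, k)%:R.
Proof.
rewrite hornerZ horner_prod; apply: (mulfI (fact_neq0 k)).
rewrite mulrA divff ?fact_neq0 // mul1r -natrM mulnC bin_ffact ffact_prod.
rewrite big_mkord natr_prod; case: (leqP k t) => [le|lt].
  apply: eq_bigr => i _.
  rewrite !hornerE natrB ?(ltnW (leq_trans (ltn_ord i) le)) //.
  by rewrite -!(natr1 _) opprD addrACA subrr addr0.
rewrite (bigD1 (Ordinal lt)) //= !hornerE subrr mul0r.
by rewrite (bigD1 (Ordinal lt)) //= subnn mul0r.
Qed.

Lemma size_binpoly k : size (binpoly k) = k.+1.
Proof.
rewrite size_scale ?invr_eq0 ?fact_neq0 // size_prod_XsubC.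
by rewrite /index_iota size_iota subn0.
Qed.

Lemma lead_coef_binpoly k : lead_coef (binpoly k) = k`!%:R^-1.
Proof. by rewrite lead_coefZ (monicP (monic_prod_XsubC _ _ _)) mulr1. Qed.

Section Multiplicity.
Variables (K : fieldType) (n : nat).
Implicit Types (I : {mpoly K[n]} -> Prop) (face : pred {set 'I_n}).

Lemma sr_hilbert_polynomial face t : (0 < t)%N ->
  (\sum_(F | face F && (F != set0)) binpoly #|F|.-1).[t%:R]
    = (sr_hilbert face t)%:R.
Proof.
case: t => // t _; rewrite horner_sum sr_hilbert_sum.
rewrite [in RHS](bigID (fun F => F != set0)) /= [X in (_ + X)%N]big1 ?addn0.
  rewrite natr_sum; apply: eq_bigr => F /andP [_ F0].
  by rewrite binpolyE card_monomials_support.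
move=> F /andP [_]; rewrite negbK => /eqP ->; apply/eqP; rewrite cards_eq0.
apply/eqP/setP => m; rewrite !inE; apply/negP => /andP [/eqP dm /eqP sm].
have: mdeg m = 0%N; last by rewrite dm.
rewrite mdegE big1 // => i _; apply/eqP; rewrite -leqn0 leqNgt.
by have /setP/(_ i) := sm; rewrite !inE => ->.
Qed.

(** The multiplicity is the number of faces of largest cardinality. *)
Lemma sr_multiplicity I face d :
    (forall p, I p <-> sr_ideal face p) ->
    (forall F, face F -> (#|F| <= d)%N) ->
    (exists2 F, face F & #|F| = d) ->
  is_multiplicity I #|[set F | face F & #|F| == d]|.
Proof.
move=> IE led [F0 fF0 cF0]; set e := #|_|.
have e0 : (0 < e)%N by apply/card_gt0P; exists F0; rewrite inE fF0 cF0 eqxx.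
exists (sr_hilbert face).
exists (\sum_(F | face F && (F != set0)) binpoly #|F|.-1), 1%N.
split; [exact: sr_hilbert_function | exact: sr_hilbert_polynomial |].
case: d led cF0 @e e0 => [|d] led cF0 e e0.
  (* The only face is the empty set, and S/I is the ground field. *)
  rewrite big1 => [|F /andP [/led]]; last by rewrite leqn0 cards_eq0 => ->.
  rewrite eqxx big_ord1 sr_hilbert_sum /e -sum1dep_card big_mkcondr.
  congr (_%:R).
  apply: eq_bigr => F fF; have := led F fF; rewrite leqn0 => cF; rewrite cF.
  move: cF; rewrite cards_eq0 => /eqP ->; apply/esym/eqP/cards1P.
  exists bm0; apply/setP => m; rewrite !inE bmeqP /= -mdeg_eq0.
  case: eqP => //= m0; apply/eqP/setP => i; rewrite !inE ltnNge leqn0.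
  by have /eqP := m0; rewrite mdeg_eq0 => /eqP ->; rewrite mnm0E.
set P := \sum_(F | _) _.
have szP : (size P <= d.+1)%N.
  apply: leq_trans (size_sum _ _ _) _.
  apply/bigmax_leqP => F /andP [/led cF F1].
  by rewrite size_binpoly prednK // card_gt0.
have coP : P`_d = e%:R / d`!%:R.
  rewrite /P coef_sum (bigID (fun F : {set 'I_n} => #|F| == d.+1)) /=.
  rewrite [X in _ + X]big1 => [|F /andP [/andP [/led cF F1] ne]].
    rewrite (eq_bigr (fun=> d`!%:R^-1)) => [|F /andP [_ /eqP ->]].
      rewrite sumr_const addr0 mulr_natl; congr (_ *+ _); apply: eq_card => F.
      rewrite !inE !unfold_in /=.
      case: (eqVneq F set0) => [->|]; rewrite ?andbT //.
      by rewrite cards0 !andbF.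
    by rewrite -lead_coef_binpoly /lead_coef size_binpoly.
  rewrite nth_default // size_binpoly prednK ?card_gt0 //.
  by move: cF; rewrite leq_eqVlt (negPf ne).
have Pd : P`_d != 0.
  rewrite coP mulf_neq0 ?invr_eq0 ?fact_neq0 //.
  by rewrite Num.Theory.pnatr_eq0 -lt0n.
have sP : size P = d.+1.
  apply/eqP; rewrite eqn_leq szP ltnNge; apply: contra Pd => le.
  by rewrite nth_default.
rewrite -size_poly_eq0 sP /= /lead_coef sP /= coP mulrC divfK //.
exact: fact_neq0.
Qed.

End Multiplicity.

(** * Squarefree Borel ideals *)

Section SquarefreeBorel.
Variables (K : fieldType) (n : nat).
Implicit Types (I : {mpoly K[n]} -> Prop) (face : pred {set 'I_n}).
Implicit Types (F U : {set 'I_n}).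

(** The elements of [F] smaller than [c] as 0-based indices; [below setT c] is
    the initial segment [0, c). *)
Definition below F c : {set 'I_n} := [set i in F | (i < c)%N].

Lemma mesym1_exchange F (i j : 'I_n) : j \in F -> i \notin F ->
  (mesym1 F - U_(j) + U_(i))%MM = mesym1 (i |: F :\ j).
Proof.
move=> jF iF; apply/mnmP => k; rewrite !mnmE !inE.
have [ik|ik] := eqVneq i k; first by rewrite -ik (negPf iF) addn1.
by rewrite addn0 (eq_sym k j); have [<-|] := eqVneq j k; rewrite ?jF ?subn0.
Qed.

(** If [F] dominates [U] in the Borel order and x_U is in the ideal, so is x_F:
    the least [j] in [U] outside [F] is exchanged for some smaller [i] in [F]
    outside [U], which keeps the domination and brings [U] closer to [F]. *)
Lemma sqfree_borel_below I face F U : down_closed face ->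
    (forall p, I p <-> sr_ideal face p) -> sqfree_borel I ->
    (forall c, #|below U c| <= #|below F c|)%N ->
  ~~ face U -> ~~ face F.
Proof.
move=> dc IE [_ bor].
have mono V : ~~ face V <-> I 'X_[mesym1 V].
  by rewrite IE sr_idealX msupport_mesym1.
have [k] := ubnP #|U :\: F|; elim: k U => // k IH U; rewrite ltnS => ck le nU.
have [UF|UF] := boolP (U \subset F); first by apply: contra nU; apply: dc.
have [j0 j0P] : exists j, j \in U :\: F.
  by move: UF; rewrite -setD_eq0 => /set0Pn.
have [j jUF jmin] :=
  @arg_minnP _ j0 (fun j => j \in U :\: F) (@nat_of_ord n) j0P.
have /andP [jF jU] : (j \notin F) && (j \in U) by rewrite /= inE in jUF.
have UFj (l : 'I_n) : l \in U -> (l < j)%N -> l \in F.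
  move=> lU lj; apply: contraTT lj => lF; rewrite -leqNgt; apply: jmin.
  by rewrite /= inE lF.
(* Below j, the set U is contained in F, and it has fewer elements than F
   because the domination at j + 1 counts j on the side of U only. *)
have [i] : exists i, i \in below F j :\: below U j.
  apply/set0Pn; rewrite setD_eq0; apply/negP => /subset_leq_card.
  apply/negP; rewrite -ltnNge.
  have -> : below F j = below F j.+1.
    apply/setP => l; rewrite !inE ltnS [in RHS]leq_eqVlt.
    by have [/val_inj ->|] := eqVneq (l : nat) j; rewrite ?(negPf jF).
  apply: leq_trans (le j.+1); apply: proper_card; apply/properP; split.
    by apply/subsetP => l; rewrite !inE => /andP [-> /ltnW].
  by exists j; rewrite !inE jU ?ltnS ?leqnn ?ltnn.
rewrite !inE => /andP [+ /andP [iF ij]]; rewrite ij andbT => iU.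
pose V := i |: U :\ j.
apply: (IH V).
- have : V :\: F \proper U :\: F.
    apply/properP; split; last first.
      exists j => //; rewrite !inE jF eqxx orbF /=.
      by apply: contraNneq jF => ->.
    apply/subsetP => l; rewrite !inE => /andP [lF /orP [/eqP li|/andP [_ ->]]].
      by rewrite li iF in lF.
    by rewrite lF.
  by move/proper_card/leq_trans; apply.
- move=> c; have [ci|ic] := leqP c i.
    apply: leq_trans (le c); apply/subset_leq_card/subsetP => l.
    rewrite !inE => /andP [/orP [/eqP ->|/andP [_ ->] -> //]].
    by rewrite ltnNge ci.
  have [cj|jc] := leqP c j.
    apply/subset_leq_card/subsetP => l; rewrite !inE => /andP [/orP [/eqP ->|]].
      by rewrite iF ic.
    by move=> /andP [_ lU] lc; rewrite lc UFj // (leq_trans lc).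
  have -> : below V c = i |: (below U c :\ j).
    apply/setP => l; rewrite !inE; have [->|_] := eqVneq l i; rewrite ?ic //=.
    by rewrite andbA.
  rewrite cardsU1 !inE (negPf iU) !andbF /=.
  by have := le c; rewrite [#|below U c|](cardsD1 j) !inE jU jc.
apply/mono; rewrite -mesym1_exchange //; apply: bor.
- exact: sqfree_mesym1.
- exact/mono.
- by rewrite msupport_mesym1.
- exact: ij.
- by rewrite mesym1_exchange // sqfree_mesym1.
Qed.

Lemma card_initial c : (c <= n)%N -> #|below setT c| = c.
Proof.
move=> cn; rewrite -[RHS]card_ord -[RHS]sum1_card.
rewrite (big_ord_widen n (fun=> 1%N) cn) -sum1_card.
by apply: eq_bigl => i; rewrite !inE.
Qed.

Lemma card_belowC F c :
  (#|below F c| + #|below (~: F) c|)%N = #|below setT c|.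
Proof.
rewrite -(cardsID F (below setT c)); congr (_ + _)%N.
  by apply: eq_card => i; rewrite !inE andbC.
by apply: eq_card => i; rewrite !inE.
Qed.

(** The first block is the interval [[p, q)], where [p] is the least index of
    the support.  By maximality of the block, [q] is not in the support. *)
Lemma first_blockP (u : 'X_{1..n}) (B : {set 'I_n}) (q := max_index B) :
  first_block u B -> exists p,
    [/\ (p < q <= n)%N, B = below setT q :\: below setT p,
        forall i, i \in msupport u -> (p <= i)%N
      & forall i, i \in msupport u -> i != q :> nat].
Proof.
move=> /andP [/maxsetP [/andP [/subsetP Bu cB] maxB]].
move=> /existsP [a /andP [aB /andP [_ /forallP au]]].
have {}au i : i \in msupport u -> (a <= i)%N by apply/implyP.
have {}cB (x y z : 'I_n) : x \in B -> y \in B -> (x <= z <= y)%N -> z \in B.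
  move=> xB yB xyz; move: cB => /forallP/(_ x); rewrite xB => /forallP/(_ y).
  by rewrite yB => /forallP/(_ z); rewrite xyz.
have Bq i : i \in B -> (i < q)%N.
  by move=> iB; rewrite /q /max_index (bigD1 i iB) /= leq_maxl.
have B0 : (0 < #|B|)%N by apply/card_gt0P; exists a.
have [b bB qb] := eq_bigmax_cond (fun i : 'I_n => i.+1) B0.
have {}qb : q = b.+1 by [].
have BE : B = below setT q :\: below setT a.
  apply/setP => i; rewrite !inE -leqNgt; apply/idP/andP => [iB|[ai iq]].
    by rewrite Bq // au // Bu.
  by apply: (cB a b); rewrite // ai -ltnS -qb.
exists a; split=> // [|i iu]; first by rewrite Bq // qb ltn_ord.
apply/eqP => iq.
have : i |: B = B.
  apply: maxB; last exact: subsetUr.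
  apply/andP; split.
    by apply/subsetP => l; rewrite in_setU1 => /orP [/eqP ->|/Bu].
  have E (l : 'I_n) : (l \in i |: B) = (a <= l <= q)%N.
    rewrite BE !inE -leqNgt [(l <= q)%N]leq_eqVlt -iq; have [->|] := eqVneq l i.
      by rewrite eqxx au.
    by rewrite -(inj_eq val_inj) /= => /negPf ->.
  apply/forallP => x; apply/implyP; rewrite E => /andP [ax _].
  apply/forallP => y; apply/implyP; rewrite E => /andP [_ yq].
  apply/forallP => z; apply/implyP; rewrite E => /andP [xz zy].
  by rewrite (leq_trans ax xz) (leq_trans zy yq).
by move/setP/(_ i); rewrite setU11 => /esym /Bq; rewrite iq ltnn.
Qed.

(** [U] stands for a support whose first block is [[p, q)].  Such a set misses
    [[0, p)] and [q], so it is dominated by any set [F] whose complement has at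
    most [p] elements, or has [p.+1] elements not all of them below [q]. *)
Lemma card_below_first_block U F p q : (p < q <= n)%N ->
    (forall i, i \in U -> (p <= i)%N) ->
    (forall i, i \in U -> i != q :> nat) ->
    (#|~: F| <= p)%N \/ (#|~: F| = p.+1 /\ ~~ (~: F \subset below setT q)) ->
  forall c, (#|below U c| <= #|below F c|)%N.
Proof.
move=> /andP [pq qn] Up Uq HF c.
(* Equivalently, F has below c at most as many missing elements as U. *)
rewrite -(leq_add2r (#|below (~: U) c| + #|below (~: F) c|)) addnA card_belowC.
rewrite [(#|below (~: U) c| + _)%N]addnC addnA card_belowC leq_add2l.
have belowC G : (#|below G c| <= #|G|)%N.
  by apply/subset_leq_card/subsetP => i; rewrite inE => /andP [].
have [cp|pc] := leqP c p.
  apply/subset_leq_card/subsetP => i; rewrite !inE => /andP [_ ic].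
  rewrite ic andbT; apply/negP => /Up; rewrite leqNgt.
  by rewrite (leq_trans ic cp).
have Pc : below setT p \subset below (~: U) c.
  apply/subsetP => i; rewrite !inE /= => ip; rewrite (ltn_trans ip pc) andbT.
  by apply/negP => /Up; rewrite leqNgt ip.
have pU : (p <= #|below (~: U) c|)%N.
  by rewrite -{1}(card_initial (ltnW (leq_trans pq qn))) subset_leq_card.
case: HF => [Fp|[Fp /subsetPn [x xF xq]]].
  exact: leq_trans (leq_trans (belowC _) Fp) pU.
rewrite !inE /= -leqNgt in xq.
have [cq|qc] := leqP c q.
  apply: leq_trans pU; rewrite -ltnS -Fp; apply: proper_card.
  apply/properP; split; first by apply/subsetP => i; rewrite !inE => /andP [].
  by exists x => //; rewrite !inE (leq_gtF (leq_trans cq xq)) andbF.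
have qn' : (q < n)%N := leq_ltn_trans xq (ltn_ord x).
apply: leq_trans (belowC _) _; rewrite Fp.
rewrite -[p in p.+1](card_initial (ltnW (leq_trans pq qn))); apply: proper_card.
apply/properP; split=> //; exists (Ordinal qn'); rewrite !inE /= ?qc ?andbT.
  by apply/negP => /Uq; rewrite eqxx.
by rewrite -leqNgt ltnW.
Qed.

(** The squarefree monomials x_F such that [F] misses at most [p] elements of
    [[0, q)] span a squarefree Borel ideal. *)
Lemma sqfree_borel_missing q p :
  sqfree_borel (sr_ideal (K := K) [pred F | p < #|below setT q :\: F|]%N).
Proof.
have dc : down_closed [pred F : {set 'I_n} | p < #|below setT q :\: F|]%N.
  move=> F G FG /= /leq_trans; apply; apply: subset_leq_card; exact: setDS.
split=> [|u su /sr_idealX uI i j ju ij sv]; first exact: sr_ideal_sqfree.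
have iu : i \notin msupport u.
  rewrite inE; have /forallP/(_ i) := sv; rewrite !mnmE eqxx addn1 ltnS leqn0.
  by rewrite -(inj_eq val_inj) (gtn_eqF ij) subn0 lt0n negbK.
apply/sr_idealX.
rewrite -(mesym1_msupport su) mesym1_exchange // msupport_mesym1.
move: (msupport u) uI ju iu => U /= + jU iU; rewrite -!leqNgt; apply: leq_trans.
have [jq|qj] := ltnP j q; last first.
  apply/subset_leq_card/subsetP => k; rewrite !inE /=.
  case/andP => + kq; rewrite kq andbT; apply: contra => kU.
  rewrite kU andbT; apply/orP; right; apply: contraTneq kq => ->.
  by rewrite -leqNgt.
rewrite [leqRHS](cardsD1 i) !inE iU (ltn_trans ij jq) /=.
apply: leq_trans (_ : #|j |: (below setT q :\: U) :\ i| <= _)%N; last first.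
  by rewrite cardsU1 leq_add2r leq_b1.
apply/subset_leq_card/subsetP => k; rewrite !inE /= => /andP [+ ->].
by case: (k == i); case: (k == j); case: (k \in U).
Qed.

End SquarefreeBorel.

Theorem theorem3p2 (K : fieldType) (n m : nat) (u : 'I_m -> 'X_{1..n})
  (I : {mpoly K[n]} -> Prop) (B : 'I_m -> {set 'I_n}) (j : 'I_m)
  (u_sqfree : forall i, sqfree (u i))
  (u_neq1 : forall i, u i != 0%MM)
  (I_gen : sqfree_borel_generated I u)
  (B_first : forall i, first_block (u i) (B i))
  (B_min : forall i, B j \subset B i) :
  is_multiplicity I 'C(max_index (B j), #|B j|.-1).
Proof.
have [bI uI minI] := I_gen.
have [face dc IE] := sqfree_monomial_idealP bI.1.
have [p [/andP [pq qn] BE Up Uq]] := first_blockP (B_first j).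
set q := max_index (B j) in pq qn BE Uq *; set Q := below setT q in BE.
have pn := leq_trans pq qn.
have nfU : ~~ face (msupport (u j)) by apply/sr_idealX/IE.
have pq' : (p < q <= n)%N by rewrite pq.
have upper F : face F ->
    (p < #|~: F|)%N /\ (#|~: F| = p.+1 -> ~: F \subset Q).
  move=> fF; have lub HF := sqfree_borel_below dc IE bI
    (card_below_first_block pq' Up Uq HF) nfU.
  split=> [|cF].
    by apply: contraTT fF; rewrite -leqNgt => le; apply: lub; left.
  by apply: contraTT fF => nFQ; apply: lub; right.
have cB : #|Q :\: B j| = p.
  rewrite BE setDDr setDv set0U (setIidPr _) ?card_initial ?(ltnW pn) //.
  by apply/subsetP => i; rewrite !inE => /ltn_trans; apply.
have lower F : ~: F \subset Q -> #|~: F| = p.+1 -> face F.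
  move=> FQ cF; apply/negPn/negP => nF.
  have : sr_ideal [pred F | p < #|Q :\: F|]%N ('X_[mesym1 F] : {mpoly K[n]}).
    apply: minI (sqfree_borel_missing K n q p) _ _ _ => [i|].
      apply/sr_idealX; rewrite /= -leqNgt -cB subset_leq_card // setDS //.
      have /andP [/maxsetP [/andP [Bu _] _] _] := B_first i.
      exact: subset_trans (B_min i) Bu.
    by apply/IE/sr_idealX; rewrite msupport_mesym1.
  move/sr_idealX; rewrite msupport_mesym1 /= setDE (setIidPr FQ) cF.
  by rewrite ltnSn.
have cF (F : {set 'I_n}) : (#|F| + #|~: F|)%N = n by rewrite cardsC card_ord.
have cBj : #|B j|.-1 = (q - p.+1)%N.
  rewrite BE cardsDS ?card_initial ?(ltnW pn) // ?subnS //.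
  by apply/subsetP => i; rewrite !inE => /ltn_trans; apply.
have count : #|[set F | face F & #|F| == (n - p.+1)%N]| = 'C(q, #|B j|.-1).
  rewrite cBj bin_sub // -[q in RHS](card_initial qn) -cards_draws.
  rewrite -[RHS](card_imset _ (@setC_inj _)); apply: eq_card => F.
  rewrite inE; apply/andP/imsetP => [[fF /eqP dF]|[C]].
    have cC : #|~: F| = p.+1.
      by apply/eqP; rewrite -(eqn_add2l #|F|) cF dF subnK.
    exists (~: F); rewrite ?setCK // inE cC eqxx andbT.
    by have [_] := upper F fF; apply.
  rewrite inE => /andP [CQ /eqP cC] ->.
  split; first by apply: lower; rewrite setCK.
  by rewrite -(eqn_add2l #|C|) cF cC subnKC.
rewrite -count; apply: sr_multiplicity IE _ _ => [F /upper [pF _]|].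
  by rewrite leq_subRL // addnC -[leqRHS](cF F) leq_add2l.
have : (0 < #|[set F | face F & #|F| == (n - p.+1)%N]|)%N.
  by rewrite count cBj bin_gt0 leq_subr.
by case/card_gt0P => F; rewrite inE => /andP [fF /eqP]; exists F.
Qed.
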